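(* Let $G=(V,E,w,m,d_0)$ be a finite weighted graph with $\mathrm{Deg}(x)\le 1$ for all $x\in V$ and initial path metric $d_0$. Let $0<\alpha<1$, and let $C$ be a constant with $C>\max_{x\sim y\sim z}\frac{d_0(x,y)}{d_0(y,z)}$. Run the discrete Ricci flow with surgery described in the context, producing metrics $d_n$, $n\ge 0$, and let $\tilde G$ be the final graph, i.e. the graph remaining after the last edge deletion. Then on each connected component $H$ of $\tilde G$ the normalized edge lengths $$\frac{d_n(e)}{\max_{e'\in E(H)}d_n(e')},\qquad e\in E(H),$$ converge as $n\to\infty$ to a metric $d$ of constant curvature on $H$, i.e. $d(e)>0$ for all $e\in E(H)$ and, with $d$ extended to all pairs of vertices of $H$ as a path metric, the Ollivier Ricci curvature $\kappa_d(x,y)$ takes the same value for all edges $x\sim y$ of $H$.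
   Context: Weighted graph: $V$ is the vertex set, $w:V\times V\to[0,\infty)$ is symmetric with zero diagonal, $m:V\to(0,\infty)$, $E=\{(x,y):w(x,y)>0\}$, and $x\sim y$ means $(x,y)\in E$. $\mathrm{Deg}(x)=\sum_{y\sim x}\frac{w(x,y)}{m(x)}$. A metric $d:V^2\to[0,\infty)$ is a path metric if $d(x,y)=\inf\{\sum_{i=1}^n d(x_{i-1},x_i): x=x_0\sim\dots\sim x_n=y\}$. Ollivier curvature: when $\mathrm{Deg}\le1$, let $\mu_x$ be the probability measure $\mu_x(x)=1-\mathrm{Deg}(x)$, $\mu_x(z)=w(x,z)/m(x)$ for $z\sim x$, and $\mu_x(z)=0$ otherwise. For a metric $d$, let $W_d(\mu_x,\mu_y)=\inf_\pi\sum_{u,v}\pi(u,v)d(u,v)$ be the Wasserstein distance, the infimum being over couplings $\pi$ of $\mu_x$ and $\mu_y$. Set $\kappa_d(x,y)=1-\frac{W_d(\mu_x,\mu_y)}{d(x,y)}$ for $x\ne y$. Discrete Ricci flow with surgery: start with the graph $G$ and the metric $d_0$. For $n=0,1,2,\dots$, perform on the current graph: Step 1. For each edge $x\sim y$ put $d_{n+1}(x,y)=d_n(x,y)-\alpha\,\kappa_{d_n}(x,y)\,d_n(x,y)$, with $\kappa_{d_n}$ computed in the current graph on each connected component. Step 2. If adjacent edges $x\sim y\sim z$ satisfy $d_{n+1}(x,y)>C\,d_{n+1}(y,z)$, delete the edge $x\sim y$. Deletions proceed in non-increasing order of edge length (ties broken by order of appearance), each test being made among the edges still present. Deleting an edge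 $x\sim y$ means setting $w(x,y)=w(y,x)=0$, with $m$ unchanged. Step 3. On each connected component of the updated graph, for non-adjacent vertices $x,y$ put $d_{n+1}(x,y)=\inf\{\sum_{i=1}^k d_{n+1}(x_{i-1},x_i): x=x_0\sim x_1\sim\dots\sim x_k=y\}$. Since the graph is finite, only finitely many deletions occur. The flow is then continued for all $n$ on the final graph $\tilde G$; components are considered only if they contain at least one edge. *)

(* Defs.v *)
From mathcomp Require Import all_boot all_order all_algebra.
From mathcomp Require Import all_classical all_reals all_analysis.
Import Order.TTheory GRing.Theory Num.Theory.
Import numFieldNormedType.Exports.

Set Implicit Arguments.
Unset Strict Implicit.
Unset Printing Implicit Defensive.

Local Open Scope classical_set_scope.
Local Open Scope ring_scope.

Record weighted_graph (R : realType) (V : finType)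
    (w : V -> V -> R) (m : V -> R) : Prop := WeightedGraph {
  wg_ge0 : forall x y, 0 <= w x y;
  wg_sym : forall x y, w x y = w y x;
  wg_diag : forall x, w x x = 0;
  wg_mass : forall x, 0 < m x }.

Section Definitions.
Variables (R : realType) (V : finType).
Implicit Types (w d l : V -> V -> R) (m mu nu : V -> R) (x y z : V).
Implicit Types (H : {set V}) (e : V * V).

Definition adj w : rel V := fun x y => 0 < w x y.

Definition Deg w m x : R := \sum_(y | adj w x y) w x y / m x.

(* The walk is [x :: p]; its length is 0 when [p] is empty. *)
Definition walk_length l x (p : seq V) : R := \sum_(t <- pairmap l x p) t.

(* Equal to +oo when [x] and [y] lie in different connected components. *)
Definition path_inf w l x y : \bar R :=
  ereal_inf [set (walk_length l x p)%:E
            | p in [set p : seq V | path (adj w) x p /\ last x p = y]].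

Record metric_on H d : Prop := MetricOn {
  metric_ge0 : {in H &, forall x y, 0 <= d x y};
  metric_eq0 : {in H &, forall x y, d x y = 0 <-> x = y};
  metric_sym : {in H &, forall x y, d x y = d y x};
  metric_triangle : {in H & H & H, forall x y z, d x z <= d x y + d y z} }.

(* The equation is in the extended reals, so [H] is included in a single
   connected component of [w]. [H] is meant to be the whole vertex set or a
   connected component, so that walks between points of [H] stay in [H]. *)
Definition path_metric_on w H d : Prop :=
  metric_on H d /\ {in H &, forall x y, (d x y)%:E = path_inf w d x y}.

Definition rw_measure w m x z : R :=
  if z == x then 1 - Deg w m x else if adj w x z then w x z / m x else 0.

Definition couplings mu nu : set (V -> V -> R) :=
  [set pi | [/\ forall u v, 0 <= pi u v,
                forall u, \sum_v pi u v = mu u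
              & forall v, \sum_u pi u v = nu v]].

Definition wasserstein d mu nu : R :=
  inf [set \sum_u \sum_v pi u v * d u v | pi in couplings mu nu].

(* For [x] and [y] in the same connected component, the two measures, hence
   all their couplings, are supported in that component: only the values of
   [d] inside the component matter. *)
Definition curvature w m d x y : R :=
  1 - wasserstein d (rw_measure w m x) (rw_measure w m y) / d x y.

(* Every edge occurs exactly once in [es], in one of its two orientations.
   The order of [es] is the order of appearance used to break ties. *)
Definition edge_listing w (es : seq (V * V)) : Prop :=
  all (fun e => adj w e.1 e.2) es /\
  forall x y, adj w x y ->
    (count_mem (x, y) es + count_mem (y, x) es = 1)%N.

Definition delete_edge w e : V -> V -> R :=
  fun u v => if ((u, v) == e) || ((v, u) == e) then 0 else w u v.

Definition too_long (C : R) w l x y : bool :=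
  [exists z, adj w y z && (C * l y z < l x y)].

(* [sort] is stable, so edges of equal length are kept in the order of [es]. *)
Definition surgery (C : R) (es : seq (V * V)) w l : V -> V -> R :=
  foldl (fun w' e => if too_long C w' l e.1 e.2 || too_long C w' l e.2 e.1
                     then delete_edge w' e else w')
    w
    (sort (fun e f => l f.1 f.2 <= l e.1 e.2)
          [seq e <- es | adj w e.1 e.2]).

(* Across distinct connected components, [fine] sends +oo to the meaningless
   value 0; by the remark on [curvature] this value is never used. *)
Definition path_extension w l : V -> V -> R :=
  fun x y => if adj w x y then l x y else fine (path_inf w l x y).

Definition flow_lengths (alpha : R) w m d : V -> V -> R :=
  fun x y => d x y - alpha * curvature w m d x y * d x y.

Definition flow_step (alpha C : R) (es : seq (V * V)) m
    (s : (V -> V -> R) * (V -> V -> R)) : (V -> V -> R) * (V -> V -> R) :=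
  let l := flow_lengths alpha s.1 m s.2 in
  let w' := surgery C es s.1 l in
  (w', path_extension w' l).

(* The [n]-th current edge weights, paired with the metric d_n. *)
Definition ricci_flow (alpha C : R) (es : seq (V * V)) w m d0 (n : nat) :
    (V -> V -> R) * (V -> V -> R) :=
  iter n (flow_step alpha C es m) (w, d0).

Definition flow_graph alpha C es w m d0 n :=
  (ricci_flow alpha C es w m d0 n).1.

Definition flow_metric alpha C es w m d0 n :=
  (ricci_flow alpha C es w m d0 n).2.

Definition is_component w H : Prop :=
  exists x, H = [set y | connect (adj w) x y]%SET.

Definition edges_in w H : {set V * V} :=
  [set e | [&& e.1 \in H, e.2 \in H & adj w e.1 e.2]]%SET.

(* Edge lengths being positive, the default value 0 is irrelevant as soon as
   [H] has an edge. *)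
Definition max_length w H d : R :=
  \big[Num.max/0]_(e in edges_in w H) d e.1 e.2.

Definition constant_curvature w m H d : Prop :=
  [/\ forall e, e \in edges_in w H -> 0 < d e.1 e.2,
      path_metric_on w H d
    & exists k : R, forall e, e \in edges_in w H ->
        curvature w m d e.1 e.2 = k].

End Definitions.

(* Main.v *)
(** Once the graph is stable, the edge lengths of a component evolve by [f |->
    (1 - alpha) f + alpha W f], where [W f] gives the Wasserstein distances
    for the path metric generated by [f]; this map is monotone and
    homogeneous. Since nothing is deleted any more, adjacent lengths have
    ratio at most [C], so the orbit stays bounded in Hilbert's projective
    metric.

    Let [g] be a limit of normalized lengths along an ultrafilter and [G j]
    the orbit of [g]. The maximum of [G j.+1 / G j] is independent of [j], say
    [lam], being a limit of a nonincreasing sequence along the original orbit.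
    If an edge attains it at time [j.+1], then it already did at time [j],
    because of the [(1 - alpha)] part. Hence [G j e = lam ^+ j * g e] for some
    [e], so the nonincreasing sequence [G j / lam ^+ j] does not vanish and
    converges. Thus the minimum of [G j.+1 / G j], also independent of [j], is
    [lam] too, and [g] is an eigenvector. The oscillation of the original
    orbit relative to [g] is nonincreasing and tends to 1 along the
    ultrafilter, which gives convergence along the whole sequence. An
    eigenvector is a metric of constant curvature; it is a path metric because
    the triangle inequality for the Wasserstein distance keeps edges geodesic
    along the flow. *)
Require Import Defs.
From mathcomp Require Import all_boot all_order all_algebra.
From mathcomp Require Import all_classical all_reals all_analysis.
From mathcomp Require Import ring lra.
Import Order.TTheory GRing.Theory Num.Theory.
Import numFieldNormedType.Exports.

Set Implicit Arguments.
Unset Strict Implicit.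
Unset Printing Implicit Defensive.

Local Open Scope classical_set_scope.
Local Open Scope ring_scope.

(** * Nonlinear Perron-Frobenius theory *)

(** A set in a finer filter whose preimage is not in [U] would have its complement in that filter
    too. This lets compactness of a segment, in its ultrafilter form, apply to a sequence pushed
    forward along [U]. *)
Lemma ultra_fmap (S S' : Type) (f : S -> S') (U : set_system S) :
  UltraFilter U -> UltraFilter (f @ U).
Proof.
move=> UU; have FU : ProperFilter U := ultra_proper.
split=> [|G GG UG]; first exact: fmap_proper_filter.
rewrite eqEsubset; split=> // D GD.
have [//|UD] := in_ultra_setVsetC (f @^-1` D) UU.
have /UG GDC : (f @ U) (~` D) by [].
have := @filterI _ G (@filter_filter _ _ GG) _ _ GD GDC; rewrite setICr => G0.
by case: (@filter_not_empty _ G GG G0).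
Qed.

Section NonlinearPerronFrobenius.
Variables (R : realType) (T : finType) (A : {set T}).
Implicit Types (f g h : T -> R) (e : T) (c : R).

Definition positive_on f := {in A, forall e, 0 < f e}.

(** For positive functions, [ln (max_ratio f g * max_ratio g f)] is Hilbert's projective metric. The
    default 0 lies below every ratio. *)
Definition max_ratio f g : R := \big[Num.max/0]_(e in A) (f e / g e).

Lemma max_ratio_ge0 f g : 0 <= max_ratio f g.
Proof. exact: bigmax_ge_id. Qed.

Lemma le_max_ratio f g : positive_on g ->
  {in A, forall e, f e <= max_ratio f g * g e}.
Proof.
move=> g0 e eA; rewrite -ler_pdivrMr ?g0//.
exact: (le_bigmax_cond _ (fun e => f e / g e)).
Qed.

Lemma max_ratio_le f g c : positive_on g -> 0 <= c ->
  {in A, forall e, f e <= c * g e} -> max_ratio f g <= c.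
Proof.
move=> g0 c0 fg; apply: bigmax_le => // e eA.
by rewrite ler_pdivrMr ?g0// fg.
Qed.

Lemma max_ratio_attained f g : (exists e, e \in A) ->
  positive_on f -> positive_on g ->
  exists2 e, e \in A & f e = max_ratio f g * g e.
Proof.
move=> [e0 e0A] f0 g0; rewrite /max_ratio.
have [|e eA ->] := @eq_bigmax _ R _ 0 e0 (mem A) (fun e => f e / g e) e0A.
  by move=> e eA; rewrite divr_ge0// ltW// ?f0 ?g0.
by exists e => //; rewrite divfK// gt_eqF// g0.
Qed.

Lemma max_ratio_gt0 f g : (exists e, e \in A) ->
  positive_on f -> positive_on g -> 0 < max_ratio f g.
Proof.
move=> A0 f0 g0; have [e eA fe] := max_ratio_attained A0 f0 g0.
by have := f0 e eA; rewrite fe pmulr_lgt0// g0.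
Qed.

Lemma max_ratio_refl f : (exists e, e \in A) -> positive_on f ->
  max_ratio f f = 1.
Proof.
move=> A0 f0; have [e eA fe] := max_ratio_attained A0 f0 f0.
by apply: (mulIf (lt0r_neq0 (f0 e eA))); rewrite mul1r.
Qed.

Lemma eq_max_ratio f f' g g' :
  {in A, forall e, f e / g e = f' e / g' e} ->
  max_ratio f g = max_ratio f' g'.
Proof. by move=> fg; apply: eq_bigr => e /fg. Qed.

Lemma max_ratioZ f f' g g' c : 0 <= c ->
  {in A, forall e, f e / g e = c * (f' e / g' e)} ->
  max_ratio f g = c * max_ratio f' g'.
Proof.
move=> c0 fg; rewrite /max_ratio.
rewrite (big_morph ( *%R c) (fun x y => maxr_pMr x y c0) (mulr0 c)).
by apply: eq_bigr => e /fg.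
Qed.

Lemma cvg_bigmax (I : Type) (U : set_system I) (FU : Filter U)
    (f_ : I -> T -> R) f :
  {in A, forall e, f_ n e @[n --> U] --> f e} ->
  \big[Num.max/0]_(e in A) f_ n e @[n --> U] -->
  \big[Num.max/0]_(e in A) f e.
Proof.
move=> ff; apply: (@cvg_big R T _ _ _ max_continuous I U _ (fun e n => f_ n e)).
exact: ff.
Qed.

Lemma cvg_max_ratio (I : Type) (U : set_system I) (FU : Filter U)
    (f_ g_ : I -> T -> R) f g : positive_on g ->
  {in A, forall e, f_ n e @[n --> U] --> f e} ->
  {in A, forall e, g_ n e @[n --> U] --> g e} ->
  max_ratio (f_ n) (g_ n) @[n --> U] --> max_ratio f g.
Proof.
move=> g0 ff gg.
apply: (@cvg_bigmax _ U FU (fun n e => f_ n e / g_ n e)) => e eA.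
apply: cvgM; first exact: ff.
by apply: cvgV; [rewrite gt_eqF// g0|exact: gg].
Qed.

(** * Monotone homogeneous maps and their action on ratios *)

Variables (a : R) (Q : (T -> R) -> T -> R).
Hypothesis A_neq0 : exists e, e \in A.
Hypothesis a_gt0 : 0 < a.
Hypothesis Q_ge0 : forall f, positive_on f -> {in A, forall e, 0 <= Q f e}.
Hypothesis Q_le : forall f g c, positive_on f -> positive_on g -> 0 < c ->
  {in A, forall e, f e <= c * g e} -> {in A, forall e, Q f e <= c * Q g e}.

Let P f e := a * f e + Q f e.

Let P_gt0 f : positive_on f -> positive_on (P f).
Proof. by move=> f0 e eA; rewrite ltr_wpDr ?Q_ge0// mulr_gt0// f0. Qed.

Let P_le f g c : positive_on f -> positive_on g -> 0 < c ->
  {in A, forall e, f e <= c * g e} -> {in A, forall e, P f e <= c * P g e}.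
Proof.
move=> f0 g0 c0 fg e eA; rewrite /P mulrDr lerD ?(Q_le f0 g0 c0)//.
by rewrite mulrCA ler_pM2l// fg.
Qed.

(** Homogeneity is already contained in [Q_le]: apply it with [c] one way and with [c^-1] the other
    way. *)
Let QZ f g c : positive_on f -> positive_on g -> 0 < c ->
  {in A, forall e, f e = c * g e} -> {in A, forall e, Q f e = c * Q g e}.
Proof.
move=> f0 g0 c0 fg e eA; apply: le_anti.
rewrite (Q_le f0 g0 c0)//=; last by move=> e' /fg ->.
rewrite -ler_pdivlMl//; apply: Q_le => //; first by rewrite invr_gt0.
by move=> e' /fg ->; rewrite mulKf// gt_eqF.
Qed.

Let PZ f g c : positive_on f -> positive_on g -> 0 < c ->
  {in A, forall e, f e = c * g e} -> {in A, forall e, P f e = c * P g e}.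
Proof.
move=> f0 g0 c0 fg e eA; rewrite /P mulrDr mulrCA -fg//.
by rewrite (QZ f0 g0 c0).
Qed.

(** Nonexpansiveness in the projective metric: [P_le] with the best constant [c]. *)
Let max_ratioP f g : positive_on f -> positive_on g ->
  max_ratio (P f) (P g) <= max_ratio f g.
Proof.
move=> f0 g0; have D0 := max_ratio_gt0 A_neq0 f0 g0.
apply: max_ratio_le; [exact: P_gt0|exact: ltW|].
by apply: P_le => //; exact: le_max_ratio.
Qed.

(* Continuity comes for free from monotonicity and homogeneity: squeeze
   [P (h_ n)] between multiples of [P h]. *)
Let P_cvg (U : set_system nat) (FU : Filter U) (h_ : nat -> T -> R) h :
  positive_on h -> (forall n, positive_on (h_ n)) ->
  {in A, forall e, h_ n e @[n --> U] --> h e} ->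
  {in A, forall e, P (h_ n) e @[n --> U] --> P h e}.
Proof.
move=> h0 hn0 hh e eA.
have D0 n := max_ratio_gt0 A_neq0 (hn0 n) h0.
have D'0 n := max_ratio_gt0 A_neq0 h0 (hn0 n).
apply: (@squeeze_cvgr _ _ _ _
  (fun n => P h e / max_ratio h (h_ n)) (fun n => max_ratio (h_ n) h * P h e)).
- near=> n; rewrite ler_pdivrMr// [P (h_ n) e * _]mulrC !P_le//.
  + exact: le_max_ratio.
  + exact: le_max_ratio.
- rewrite -[X in _ --> X]divr1; apply: cvgM; first exact: cvg_cst.
  apply: cvgV; first exact: oner_neq0.
  rewrite -(max_ratio_refl A_neq0 h0); apply: cvg_max_ratio => // e' eA'.
  exact: cvg_cst.
- rewrite -[X in _ --> X]mul1r; apply: cvgM; last exact: cvg_cst.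
  rewrite -(max_ratio_refl A_neq0 h0); apply: cvg_max_ratio => // e' eA'.
  exact: cvg_cst.
Unshelve. all: by end_near. Qed.

(** By [max_ratioP] the ratios are nonincreasing, and they are bounded below by 0. This is applied
    to an orbit and its own shift, then to an orbit and the orbit of an eigenvector. *)
Let orbit_max_ratio (u v : nat -> T -> R) :
  (forall n, positive_on (u n)) -> (forall n, positive_on (v n)) ->
  (forall n, {in A, u n.+1 =1 P (u n)}) ->
  (forall n, {in A, v n.+1 =1 P (v n)}) ->
  exists2 l : R, 0 <= l & max_ratio (u n) (v n) @[n --> \oo] --> l.
Proof.
move=> u0 v0 uP vP; pose D n := max_ratio (u n) (v n).
have Dcvg : cvgn D.
  apply: nonincreasing_is_cvgn.
    apply/nonincreasing_seqP => n; rewrite /D.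
    rewrite (@eq_max_ratio _ (P (u n)) _ (P (v n))); first exact: max_ratioP.
    by move=> e eA; rewrite uP// vP.
  by exists 0 => _ [n _ <-]; exact: max_ratio_ge0.
exists (limn D); last exact: Dcvg.
by apply: limr_ge => //; near=> n; exact: max_ratio_ge0.
Unshelve. all: by end_near. Qed.

(** * Convergence of orbits whose values stay comparable *)

Variables (F : nat -> T -> R) (B : R).
Hypothesis F_gt0 : forall n, positive_on (F n).
Hypothesis F_step : forall n, {in A, F n.+1 =1 P (F n)}.
Hypothesis F_ratio : forall n, {in A &, forall e e', F n e <= B * F n e'}.

Let X n := \big[Num.max/0]_(e in A) F n e.

Let F_leX n : {in A, forall e, F n e <= X n}.
Proof. by move=> e eA; exact: (le_bigmax_cond _ (F n)). Qed.

Let X_gt0 n : 0 < X n.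
Proof.
by have [e eA] := A_neq0; rewrite (lt_le_trans (F_gt0 n eA))// F_leX.
Qed.

Let B_gt0 : 0 < B.
Proof.
have [e eA] := A_neq0; have := F_ratio 0 eA eA.
move=> /(lt_le_trans (F_gt0 0 eA)).
by rewrite pmulr_lgt0// F_gt0.
Qed.

Let X_leF n : {in A, forall e, X n <= B * F n e}.
Proof.
move=> e eA; apply: bigmax_le => [|e' e'A]; last exact: F_ratio.
by rewrite mulr_ge0 ?ltW// F_gt0.
Qed.

Let normalized_ge e n : e \in A -> B^-1 <= F n e / X n.
Proof.
by move=> eA; rewrite ler_pdivlMr// mulrC ler_pdivrMr// mulrC X_leF.
Qed.

(** Normalized values lie in the compact segment from [B^-1] to 1. One ultrafilter serves all of [A]
    at once, and the lower bound makes the limit positive. *)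
Let ultra_limit : exists2 U : set_system nat, ProperFilter U /\ \oo `<=` U &
  exists2 g, positive_on g &
  {in A, forall e, F n e / X n @[n --> U] --> g e}.
Proof.
have [U [Uultra ooU]] := @ultraFilterLemma nat \oo _.
have FU : ProperFilter U := @ultra_proper _ _ Uultra.
exists U => //.
have /choice[g gP] e : exists x : R,
    e \in A -> 0 < x /\ (F n e / X n @[n --> U] --> x).
  have [eA|_] := boolP (e \in A); last by exists 0.
  have := @segment_compact R B^-1 1.
  rewrite compact_ultra => /(_ (F n e / X n @[n --> U]) (ultra_fmap _ _)).
  have FI : U [set n | F n e / X n \in `[B^-1, 1]].
    apply: (@filterS _ U _ setT); last exact: filterT.
    move=> n _ /=; rewrite in_itv/= normalized_ge//=.
    by rewrite ler_pdivrMr// mul1r F_leX.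
  move=> /(_ FI)[x [/=]].
  rewrite in_itv/= => /andP[Bx _] Fx; exists x => _; split => //.
  by rewrite (lt_le_trans _ Bx)// invr_gt0.
by exists g => e eA; have [] := gP e eA.
Qed.

Lemma orbit_growth : exists2 h, positive_on h & exists2 c : R, 0 < c &
  {in A, forall e, P h e = c * h e} /\
  {in A, forall e, F n e / c ^+ n @[n --> \oo] --> h e}.
Proof.
have [U [FU ooU] [g g0 Ug]] := ultra_limit.
pose G j := iter j P g.
have G0 j : positive_on (G j) by elim: j => //= j; exact: P_gt0.
have F0 j n : positive_on (fun e => F (n + j) e / X n).
  by move=> e eA; rewrite divr_gt0// F_gt0.
(* Dividing by [X n] and not by [X (n + j)] makes the limit of the shifted orbit exactly the [j]-th
   iterate of [g]. *)
have UG j : {in A, forall e, F (n + j)%N e / X n @[n --> U] --> G j e}.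
  elim: j => [|j IHj] e eA.
    by under eq_fun do rewrite addn0; exact: Ug.
  rewrite [G _]/=.
  have -> : (fun n => F (n + j.+1) e / X n) =
            (fun n => P (fun e => F (n + j)%N e / X n) e).
    apply/funext => n; rewrite addnS F_step//.
    rewrite (@PZ (fun e => F (n + j)%N e / X n) (F (n + j)%N) (X n)^-1)//.
    + by rewrite mulrC.
    + by rewrite invr_gt0.
    + by move=> e' _; rewrite mulrC.
  exact: P_cvg.
have subU (u : nat -> R) (l : R) j :
    u n @[n --> \oo] --> l -> u (n + j)%N @[n --> U] --> l.
  move=> ul; apply: cvg_trans (cvg_app _ ooU) _.
  by rewrite cvg_shiftn.
(* [lam] is the limit of the largest one-step growth factor, and [mu] the limit of the inverse of
   the smallest one. *)
have [lam lam0 Flam] := orbit_max_ratio (fun n => F_gt0 n.+1) F_gt0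
  (fun n => F_step n.+1) F_step.
have [mu mu0 Fmu] := orbit_max_ratio F_gt0 (fun n => F_gt0 n.+1)
  F_step (fun n => F_step n.+1).
have ratioX i j n : max_ratio (fun e => F i e / X n) (fun e => F j e / X n) =
    max_ratio (F i) (F j).
  by apply: eq_max_ratio => e _; rewrite invf_div mulrA divfK// gt_eqF.
have uniq (W : set_system nat) (FW : ProperFilter W) (u : nat -> R) (l l' : R) :
    u n @[n --> W] --> l -> u n @[n --> W] --> l' -> l = l'.
  exact: (cvg_unique (@Rhausdorff R)).
(* The common factor [X n] cancels, so the ratio is a limit along [U] of a shift of a convergent
   sequence, whatever [j] is. *)
have Glam j : max_ratio (G j.+1) (G j) = lam.
  apply: (uniq _ FU _ _ _ (cvg_max_ratio FU (G0 j) (UG j.+1) (UG j))).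
  rewrite (funext (fun n => ratioX (n + j.+1)%N (n + j)%N n)).
  under eq_fun do rewrite addnS.
  exact: (subU _ _ j Flam).
have Gmu j : max_ratio (G j) (G j.+1) = mu.
  apply: (uniq _ FU _ _ _ (cvg_max_ratio FU (G0 j.+1) (UG j) (UG j.+1))).
  rewrite (funext (fun n => ratioX (n + j)%N (n + j.+1)%N n)).
  under eq_fun do rewrite addnS.
  exact: (subU _ _ j Fmu).
have g_gt0 e : e \in A -> 0 < g e by move=> eA; exact: g0.
have lam_gt0 : 0 < lam.
  by rewrite -(Glam 0%N); exact: max_ratio_gt0.
have Gle j : {in A, forall e, G j.+1 e <= lam * G j e}.
  by move=> e eA; rewrite -(Glam j) le_max_ratio.
(* Both terms of [a * G j.+1 e + Q (G j.+1) e] are at most [lam] times the corresponding terms at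
   time [j]. Equality of the sums forces equality of the first terms, and [a > 0] can be
   cancelled. *)
have Gtight j e : e \in A -> G j.+2 e = lam * G j.+1 e ->
    G j.+1 e = lam * G j e.
  move=> eA Ge; apply: le_anti; rewrite Gle//; change (lam * G j e <= G j.+1 e).
  have Qle := Q_le (G0 j.+1) (G0 j) lam_gt0 (Gle j) eA.
  have E1 : a * G j.+1 e + Q (G j.+1) e = lam * G j.+1 e by [].
  have E0 : G j.+1 e = a * G j e + Q (G j) e by [].
  rewrite -(ler_pM2l a_gt0).
  have : lam * G j.+1 e = lam * (a * G j e + Q (G j) e) by rewrite -E0.
  move: (G j.+1 e) (G j e) (Q (G j) e) (Q (G j.+1) e) Qle E1 => y x q q' *.
  lra.
have Gtop j e : e \in A -> G j.+1 e = lam * G j e ->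
    G j.+1 e = lam ^+ j.+1 * g e.
  move=> eA; elim: j => [|j IHj] Ge; first by rewrite expr1.
  by rewrite Ge IHj ?mulrA -?exprS//; exact: Gtight.
have g_ge e : e \in A -> B^-1 <= g e.
  move=> eA; apply: (cvgr_to_ge (Ug e eA)).
  by apply: nearW => n; exact: normalized_ge.
have G_ratio j : {in A &, forall e e', G j e <= B * G j e'}.
  move=> e e' eA e'A.
  apply: (ler_cvg_to (UG j e eA) (cvgM (cvg_cst B) (UG j e' e'A))).
  apply: nearW => n /=; rewrite mulrA ler_pM2r ?invr_gt0//.
  exact: F_ratio.
pose H j e := G j e / lam ^+ j.
(* At each time some [e'] has grown by exactly [lam] at every step since [g]. One factor [B] bounds
   [g e'] from below, the other compares [e] with [e']. *)
have H_ge j e : e \in A -> (B * B)^-1 <= H j e.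
  move=> eA; rewrite ler_pdivlMr ?exprn_gt0//.
  have [e' e'A Ge'] : exists2 e', e' \in A & G j e' = lam ^+ j * g e'.
    case: j => [|j]; first by exists e => //; rewrite expr0 mul1r.
    have [e' e'A Ge'] := max_ratio_attained A_neq0 (G0 j.+1) (G0 j).
    by exists e' => //; apply: Gtop => //; rewrite Ge' Glam.
  rewrite invfM -mulrA ler_pdivrMl// (le_trans _ (G_ratio j e' e e'A eA))//.
  by rewrite Ge' mulrC ler_pM2l ?exprn_gt0// g_ge.
have H_gt0 j : positive_on (H j).
  by move=> e eA; rewrite divr_gt0 ?exprn_gt0 ?G0.
have H_le j : {in A, forall e, H j.+1 e <= H j e}.
  move=> e eA; rewrite /H exprS invfM mulrA ler_pM2r ?invr_gt0 ?exprn_gt0//.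
  by rewrite ler_pdivrMr// mulrC Gle.
have H_cvg e : e \in A -> cvgn (H ^~ e).
  move=> eA; apply: nonincreasing_is_cvgn.
    by apply/nonincreasing_seqP => n; exact: H_le.
  by exists 0 => _ [n _ <-]; rewrite ltW// H_gt0.
have limH_gt0 : positive_on (fun e => limn (H ^~ e)).
  move=> e eA; apply: (@lt_le_trans _ _ (B * B)^-1).
    by rewrite invr_gt0 mulr_gt0.
  by apply: limr_ge; [exact: H_cvg|apply: nearW => n; exact: H_ge].
(* Successive terms of [H] have the constant ratio [mu * lam], whereas [H] converges to a positive
   limit, so that this ratio must tend to 1. *)
have lam_mu : mu * lam = 1.
  have Hratio n : max_ratio (H n) (H n.+1) = mu * lam.
    have [e eA He] := max_ratio_attained A_neq0 (G0 n) (G0 n.+1).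
    apply: le_anti; apply/andP; split.
      apply: max_ratio_le => // [|e' e'A]; first by rewrite mulr_ge0.
      rewrite /H exprS invfM -[leRHS]mulrA [lam * _]mulrCA.
      rewrite [lam * _]mulrA divff ?gt_eqF// mul1r mulrA.
      rewrite ler_pM2r ?invr_gt0 ?exprn_gt0//.
      by rewrite -(Gmu n) le_max_ratio.
    have := @le_max_ratio (H n) _ (H_gt0 n.+1) e eA.
    move: (max_ratio (H n) _) => D; rewrite /H He Gmu exprS invfM !mulrA.
    rewrite ler_pM2r ?invr_gt0 ?exprn_gt0// ler_pdivlMr// mulrAC.
    by rewrite ler_pM2r ?G0.
  have := @cvg_max_ratio _ \oo _ H (fun n => H n.+1) _ _ limH_gt0 H_cvg.
  rewrite (funext Hratio) max_ratio_refl// => cvg1.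
  apply: (uniq \oo _ (fun=> mu * lam)); first exact: cvg_cst.
  apply: cvg1 => e eA.
  by have := H_cvg e eA; rewrite -(cvg_shiftS (H ^~ e)).
(* One inequality is [P g <= lam * g]; the other is [g <= mu * P g] with [mu] the inverse of
   [lam]. *)
have geigen : {in A, forall e, P g e = lam * g e}.
  move=> e eA; apply: le_anti; rewrite (Gle 0%N)//=.
  have := @le_max_ratio g _ (G0 1%N) e eA; rewrite (Gmu 0%N).
  by rewrite -(ler_pM2l lam_gt0) mulrA [lam * mu]mulrC lam_mu mul1r.
pose v n e := lam ^+ n * g e.
have v0 n : positive_on (v n).
  by move=> e eA; rewrite mulr_gt0 ?exprn_gt0 ?g0.
have vP n : {in A, v n.+1 =1 P (v n)}.
  move=> e eA; rewrite (@PZ (v n) g (lam ^+ n)) ?exprn_gt0//.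
  by rewrite geigen// mulrA -exprSr.
have [M M0 FM] := orbit_max_ratio F_gt0 v0 F_step vP.
have [K K0 FK] := orbit_max_ratio v0 F_gt0 vP F_step.
(* The product of the two ratios is invariant under scaling either function, hence can be computed
   from [F n / X n] and [g], which merge along [U]. Since the product converges along [\oo], its
   value along [U] is its limit. *)
have MK : M * K = 1.
  have E n : max_ratio (F n) (v n) * max_ratio (v n) (F n) =
      max_ratio (fun e => F n e / X n) g * max_ratio g (fun e => F n e / X n).
    have ln0 : lam ^+ n != 0 by rewrite gt_eqF ?exprn_gt0.
    have Xn0 : X n != 0 by rewrite gt_eqF.
    rewrite (@max_ratioZ _ (fun e => F n e / X n) _ g (X n / lam ^+ n)).
    + rewrite (@max_ratioZ (v n) g _ (fun e => F n e / X n) (lam ^+ n / X n)).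
      * by rewrite mulrACA mulf_div [X n * _]mulrC divff ?mul1r ?mulf_neq0.
      * by rewrite divr_ge0// ?exprn_ge0 // ltW.
      * by move=> e eA; rewrite /v; field; rewrite Xn0 gt_eqF ?F_gt0.
    + by rewrite divr_ge0// ?exprn_ge0 // ltW.
    + by move=> e eA; rewrite /v; field; rewrite Xn0 ln0 gt_eqF ?g_gt0.
  apply: (uniq U _ (fun n => max_ratio (F n) (v n) * max_ratio (v n) (F n))).
    apply: cvgM; [have := subU _ _ 0%N FM|have := subU _ _ 0%N FK];
      by under eq_fun do rewrite addn0.
  rewrite (funext E) -[X in _ --> X]mulr1 -{1}(max_ratio_refl A_neq0 g0).
  rewrite -(max_ratio_refl A_neq0 g0).
  apply: cvgM; apply: cvg_max_ratio => // e eA;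
    by [exact: cvg_cst|exact: Ug].
have M_gt0 : 0 < M.
  rewrite lt_neqAle M0 andbT eq_sym; apply: contra_eq_neq MK => ->.
  by rewrite mul0r eq_sym oner_eq0.
have K_gt0 : 0 < K by rewrite -(pmulr_rgt0 _ M_gt0) MK.
exists (fun e => M * g e).
  by move=> e eA; rewrite mulr_gt0// g0.
exists lam => //; split=> e eA.
  have Mg0 : positive_on (fun e => M * g e).
    by move=> e' e'A; rewrite mulr_gt0// g0.
  have -> : P (fun e => M * g e) e = M * P g e by exact: PZ.
  by rewrite geigen// mulrCA.
(* The bounds tend to [g e / K] and [M * g e], which agree because [M * K = 1]. *)
apply: (@squeeze_cvgr _ _ _ _ (fun n => g e / max_ratio (v n) (F n))
  (fun n => max_ratio (F n) (v n) * g e)).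
- near=> n.
  have Kn0 := max_ratio_gt0 A_neq0 (v0 n) (@F_gt0 n).
  have ln0 : 0 < lam ^+ n by rewrite exprn_gt0.
  apply/andP; split.
    rewrite ler_pdivlMr// mulrAC ler_pdivrMr// mulrC [leRHS]mulrC.
    exact: le_max_ratio.
  rewrite ler_pdivrMr// -mulrA [g e * _]mulrC.
  exact: le_max_ratio.
- have -> : M * g e = g e / K.
    by rewrite -[in RHS](mul1r (g e)) -MK mulrAC mulfK// gt_eqF// K_gt0.
  apply: cvgM; first exact: cvg_cst.
  by apply: cvgV => //; rewrite gt_eqF.
- by apply: cvgM FM _; exact: cvg_cst.
Unshelve. all: by end_near. Qed.

(** The factor [c ^+ n] cancels between [F n e] and [X n], and [X n / c ^+ n] tends to the maximum
    of the limit. *)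
Lemma normalized_orbit_cvg : exists2 h, positive_on h & exists2 c : R, 0 < c &
  {in A, forall e, P h e = c * h e} /\
  {in A, forall e, F n e / X n @[n --> \oo] --> h e}.
Proof.
have [h h0 [c c0 [hc Fh]]] := orbit_growth.
pose s := \big[Num.max/0]_(e in A) h e.
have s0 : 0 < s.
  have [e eA] := A_neq0; rewrite (lt_le_trans (h0 e eA))//.
  exact: (le_bigmax_cond _ h).
have hs0 : positive_on (fun e => h e / s).
  by move=> e eA; rewrite divr_gt0// h0.
exists (fun e => h e / s) => //; exists c => //; split=> e eA.
  have -> : P (fun e => h e / s) e = s^-1 * P h e.
    by apply: PZ => //; [rewrite invr_gt0|move=> e' _; rewrite mulrC].
  by rewrite hc// mulrCA [s^-1 * _]mulrC.
have cn0 n : 0 < (c ^+ n)^-1 by rewrite invr_gt0 exprn_gt0.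
have Xs : X n / c ^+ n @[n --> \oo] --> s.
  have -> : (fun n => X n / c ^+ n) =
            (fun n => \big[Num.max/0]_(e in A) (F n e / c ^+ n)).
    apply/funext => n; rewrite /X.
    rewrite (big_morph ( *%R^~ (c ^+ n)^-1)
      (fun x y => maxr_pMl x y (ltW (cn0 n))) (mul0r _)).
    by [].
  exact: cvg_bigmax.
have -> : (fun n => F n e / X n) = (fun n => F n e / c ^+ n / (X n / c ^+ n)).
  apply/funext => n; rewrite invf_div mulrA divfK// gt_eqF ?exprn_gt0//.
apply: cvgM; first exact: Fh.
by apply: cvgV => //; rewrite gt_eqF.
Qed.

End NonlinearPerronFrobenius.

(** * The Wasserstein distance *)

Section Wasserstein.
Variables (R : realType) (V : finType).
Implicit Types (d pi : V -> V -> R) (mu nu rho : V -> R) (S : {set V}).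

(** The set [S] will be a connected component, the only place where the metrics of the flow are
    meaningful. *)
Definition supported_in S mu := forall u, u \notin S -> mu u = 0.

Definition probability_on S mu :=
  [/\ forall u, 0 <= mu u, \sum_u mu u = 1 & supported_in S mu].

Definition cost pi d : R := \sum_u \sum_v pi u v * d u v.

Lemma coupling_supported S mu nu pi : supported_in S mu -> supported_in S nu ->
  couplings mu nu pi -> forall u v, ~~ ((u \in S) && (v \in S)) -> pi u v = 0.
Proof.
move=> muS nuS [pi0 piu piv] u v; rewrite negb_and => /orP[uS|vS].
- have /eqP := piu u; rewrite muS// psumr_eq0// => /allP/(_ v).
  by rewrite mem_index_enum => /(_ isT)/eqP.
- have /eqP := piv v; rewrite nuS// psumr_eq0// => /allP/(_ u).
  by rewrite mem_index_enum => /(_ isT)/eqP.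
Qed.

Lemma cost_le S mu nu pi d d' : supported_in S mu -> supported_in S nu ->
  couplings mu nu pi -> {in S &, forall u v, d u v <= d' u v} ->
  cost pi d <= cost pi d'.
Proof.
move=> muS nuS pic dd; apply: ler_sum => u _; apply: ler_sum => v _.
have [/andP[uS vS]|uvS] := boolP ((u \in S) && (v \in S)).
  by rewrite ler_wpM2l ?dd//; case: pic.
by rewrite (coupling_supported muS nuS pic uvS) !mul0r.
Qed.

Lemma costZ pi d c : cost pi (fun u v => c * d u v) = c * cost pi d.
Proof.
rewrite /cost mulr_sumr; apply: eq_bigr => u _; rewrite mulr_sumr.
by apply: eq_bigr => v _; rewrite mulrCA.
Qed.

Lemma cost_ge0 S mu nu pi d : supported_in S mu -> supported_in S nu ->
  couplings mu nu pi -> {in S &, forall u v, 0 <= d u v} -> 0 <= cost pi d.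
Proof.
move=> muS nuS pic d0; rewrite -[leLHS](mul0r (cost pi d)) -costZ.
by apply: (cost_le muS nuS pic) => u v uS vS; rewrite mul0r d0.
Qed.

Lemma coupling_exists S mu nu : probability_on S mu -> probability_on S nu ->
  couplings mu nu !=set0.
Proof.
move=> [mu0 mu1 _] [nu0 nu1 _]; exists (fun u v => mu u * nu v).
split=> [u v|u|v].
- by rewrite mulr_ge0.
- by rewrite -mulr_sumr nu1 mulr1.
- by rewrite -mulr_suml mu1 mul1r.
Qed.

Section Bounds.
Variables (S : {set V}) (mu nu : V -> R).
Hypotheses (muP : probability_on S mu) (nuP : probability_on S nu).

Let muS : supported_in S mu. Proof. by case: muP. Qed.
Let nuS : supported_in S nu. Proof. by case: nuP. Qed.

Lemma wasserstein_le_cost d pi : {in S &, forall u v, 0 <= d u v} ->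
  couplings mu nu pi -> wasserstein d mu nu <= cost pi d.
Proof.
move=> d0 pic; apply: ge_inf; last by exists pi.
by exists 0 => _ [pi' pic' <-]; exact: (cost_ge0 muS nuS pic' d0).
Qed.

Lemma wasserstein_glb d c : (forall pi, couplings mu nu pi -> c <= cost pi d) ->
  c <= wasserstein d mu nu.
Proof.
move=> cle; apply: lb_le_inf => [|_ [pi pic <-]]; last exact: cle.
have [pi pic] := coupling_exists muP nuP.
by exists (cost pi d), pi.
Qed.

Lemma wasserstein_ge0 d : {in S &, forall u v, 0 <= d u v} ->
  0 <= wasserstein d mu nu.
Proof.
by move=> d0; apply: wasserstein_glb => pi pic; exact: (cost_ge0 muS nuS pic).
Qed.

(** Monotonicity and homogeneity in a single inequality, the form that [Q_le] asks for. *)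
Lemma wasserstein_leZ d d' c : 0 < c -> {in S &, forall u v, 0 <= d u v} ->
  {in S &, forall u v, d u v <= c * d' u v} ->
  wasserstein d mu nu <= c * wasserstein d' mu nu.
Proof.
move=> c0 d0 dd'; rewrite -ler_pdivrMl//; apply: wasserstein_glb => pi pic.
rewrite ler_pdivrMl// -costZ (le_trans (wasserstein_le_cost d0 pic))//.
exact: (cost_le muS nuS pic).
Qed.

Lemma wasserstein_le_sym d : {in S &, forall u v, 0 <= d u v} ->
  {in S &, forall u v, d u v = d v u} ->
  wasserstein d mu nu <= wasserstein d nu mu.
Proof.
move=> d0 dsym; apply: lb_le_inf => [|_ [pi pic <-]].
  have [pi pic] := coupling_exists nuP muP.
  by exists (cost pi d), pi.
have picT : couplings mu nu (fun u v => pi v u) by case: pic.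
rewrite (le_trans (wasserstein_le_cost d0 picT))// /cost exchange_big/=.
apply: (cost_le nuS muS pic (d := fun u v => d v u)) => u v uS vS.
by rewrite dsym.
Qed.

End Bounds.

Lemma wasserstein_refl S mu d : probability_on S mu ->
  {in S &, forall u v, 0 <= d u v} -> {in S, forall u, d u u = 0} ->
  wasserstein d mu mu = 0.
Proof.
move=> muP d0 duu; apply: le_anti; rewrite (wasserstein_ge0 muP muP d0) andbT.
pose pi u v := if u == v then mu u else 0.
have pic : couplings mu mu pi.
  split=> [u v|u|v]; rewrite /pi.
  - by case: ifP => // _; case: muP.
  - by under eq_bigr do rewrite eq_sym; rewrite -big_mkcond big_pred1_eq.
  - by rewrite -big_mkcond big_pred1_eq.
apply: le_trans (wasserstein_le_cost muP muP d0 pic) _.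
rewrite /cost big1// => u _; rewrite big1// => v _; rewrite /pi.
have [<-|] := eqVneq u v; last by rewrite mul0r.
have [uS|uS] := boolP (u \in S); first by rewrite duu// mulr0.
by case: muP => _ _ ->; rewrite ?mul0r.
Qed.

(* Glue the two couplings along their common marginal [rho]; where [rho]
   vanishes so do both couplings, and the division by 0 is harmless. *)
Lemma wasserstein_triangle S mu rho nu d :
  probability_on S mu -> probability_on S rho -> probability_on S nu ->
  {in S &, forall u v, 0 <= d u v} ->
  {in S & S & S, forall x y z, d x z <= d x y + d y z} ->
  wasserstein d mu nu <= wasserstein d mu rho + wasserstein d rho nu.
Proof.
move=> muP rhoP nuP d0 dtri.
have [_ _ muS] := muP; have [rho0 _ rhoS] := rhoP; have [_ _ nuS] := nuP.
rewrite -lerBlDr; apply: (wasserstein_glb muP rhoP) => p pc.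
rewrite lerBlDr -lerBlDl; apply: (wasserstein_glb rhoP nuP) => q qc.
rewrite lerBlDl.
have [p0 pu pz] := pc; have [q0 qz qv] := qc.
pose t u z v := p u z * q z v / rho z.
have t0 u z v : 0 <= t u z v by rewrite /t !mulr_ge0 ?invr_ge0.
have tv u z : \sum_v t u z v = p u z.
  rewrite /t -mulr_suml -mulr_sumr qz.
  have [rz0|rz0] := eqVneq (rho z) 0; last by rewrite mulfK.
  rewrite rz0 mulr0 mul0r; have /eqP := pz z; rewrite rz0 psumr_eq0//.
  by move=> /allP/(_ u); rewrite mem_index_enum => /(_ isT)/eqP.
have tu z v : \sum_u t u z v = q z v.
  rewrite /t -!mulr_suml pz.
  have [rz0|rz0] := eqVneq (rho z) 0; last by rewrite mulrAC divff// mul1r.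
  rewrite rz0 !mul0r; have /eqP := qz z; rewrite rz0 psumr_eq0//.
  by move=> /allP/(_ v); rewrite mem_index_enum => /(_ isT)/eqP.
have tc : couplings mu nu (fun u v => \sum_z t u z v).
  split=> [u v|u|v].
  - by rewrite sumr_ge0.
  - by rewrite exchange_big/=; under eq_bigr do rewrite tv.
  - by rewrite exchange_big/=; under eq_bigr do rewrite tu.
apply: le_trans (wasserstein_le_cost muP nuP d0 tc) _.
have -> : cost p d = \sum_u \sum_z \sum_v t u z v * d u z.
  by do 2!apply: eq_bigr => ? _; rewrite -mulr_suml tv.
have -> : cost q d = \sum_u \sum_z \sum_v t u z v * d z v.
  rewrite [RHS]exchange_big; apply: eq_bigr => z _.
  rewrite exchange_big; apply: eq_bigr => v _.
  by rewrite -mulr_suml tu.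
rewrite /cost -big_split/=; apply: ler_sum => u _.
under eq_bigr do rewrite mulr_suml.
rewrite exchange_big -big_split/=; apply: ler_sum => z _.
rewrite -big_split/=; apply: ler_sum => v _.
rewrite -mulrDr.
(* The triangle inequality is known only inside [S]; elsewhere the glued weight vanishes. *)
have [uS|uS] := boolP (u \in S); last first.
  have puz : p u z = 0.
    by apply: (coupling_supported muS rhoS pc); rewrite (negPf uS).
  by rewrite /t puz !mul0r.
have [zS|zS] := boolP (z \in S); last by rewrite /t rhoS// invr0 mulr0 !mul0r.
have [vS|vS] := boolP (v \in S); last first.
  have qzv : q z v = 0.
    by apply: (coupling_supported rhoS nuS qc); rewrite (negPf vS) andbF.
  by rewrite /t qzv mulr0 !mul0r.
by rewrite ler_wpM2l ?dtri.
Qed.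

End Wasserstein.

(** * Path metrics *)

Section WalkLength.
Variables (R : realType) (V : finType).
Implicit Types (l : V -> V -> R) (x y z : V) (p : seq V).

Lemma walk_length_nil l x : walk_length l x [::] = 0.
Proof. by rewrite /walk_length big_nil. Qed.

Lemma walk_length_cons l x y p :
  walk_length l x (y :: p) = l x y + walk_length l y p.
Proof. by rewrite /walk_length /= big_cons. Qed.

Lemma walk_length_cat l x p q :
  walk_length l x (p ++ q) = walk_length l x p + walk_length l (last x p) q.
Proof.
elim: p x => [|y p IHp] x; first by rewrite walk_length_nil add0r.
by rewrite !walk_length_cons IHp addrA.
Qed.

Lemma eq_walk_length (r : rel V) l l' x p :
  (forall y z, r y z -> l y z = l' y z) -> path r x p ->
  walk_length l x p = walk_length l' x p.
Proof.
move=> ll; elim: p x => [|y p IHp] x /=; first by rewrite !walk_length_nil.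
by move=> /andP[xy yp]; rewrite !walk_length_cons ll// IHp.
Qed.

End WalkLength.

Section Component.
Variables (R : realType) (V : finType) (w : V -> V -> R) (H : {set V}).
Hypothesis w_sym : symmetric (adj w).
Hypothesis H_comp : is_component w H.
Implicit Types (l : V -> V -> R) (x y z : V) (p : seq V).

Lemma component_adj x y : adj w x y -> x \in H -> y \in H.
Proof.
case: H_comp => x0 -> xy; rewrite !inE => x0x.
exact: connect_trans x0x (connect1 xy).
Qed.

Lemma component_walk x y : x \in H -> y \in H ->
  exists2 p, path (adj w) x p & last x p = y.
Proof.
case: H_comp => x0 ->; rewrite !inE => x0x x0y.
have /connectP[p xp ->] : connect (adj w) x y.
  by rewrite (connect_trans _ x0y)// (sym_connect_sym w_sym).
by exists p.
Qed.

Definition edges_on (P : V -> V -> Prop) :=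
  {in H &, forall x y, adj w x y -> P x y}.

Lemma walk_length_leZ l l' c x p : edges_on (fun x y => l x y <= c * l' x y) ->
  x \in H -> path (adj w) x p -> walk_length l x p <= c * walk_length l' x p.
Proof.
move=> ll; elim: p x => [|y p IHp] x xH /=.
  by rewrite !walk_length_nil mulr0.
move=> /andP[xy yp]; have yH := component_adj xy xH.
by rewrite !walk_length_cons mulrDr lerD ?IHp ?ll.
Qed.

Lemma walk_length_ge0 l x p : edges_on (fun x y => 0 <= l x y) ->
  x \in H -> path (adj w) x p -> 0 <= walk_length l x p.
Proof.
move=> l0; elim: p x => [|y p IHp] x xH /=; first by rewrite walk_length_nil.
move=> /andP[xy yp]; have yH := component_adj xy xH.
by rewrite walk_length_cons addr_ge0 ?IHp ?l0.
Qed.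

Section Distance.
Variables (l : V -> V -> R).
Hypothesis l_ge0 : edges_on (fun x y => 0 <= l x y).
Variables (x y : V).
Hypotheses (xH : x \in H) (yH : y \in H).

Lemma path_inf_fin : path_inf w l x y \is a fin_num.
Proof.
have [p xp px] := component_walk xH yH.
rewrite ge0_fin_numE.
  apply: le_lt_trans (ltry (walk_length l x p)).
  by apply: ereal_inf_lbound; exists p.
apply: le_ereal_inf_tmp => _ [q [xq _] <-].
by rewrite lee_fin walk_length_ge0.
Qed.

Lemma path_inf_le p : path (adj w) x p -> last x p = y ->
  fine (path_inf w l x y) <= walk_length l x p.
Proof.
move=> xp px; rewrite -lee_fin fineK ?path_inf_fin//.
by apply: ereal_inf_lbound; exists p.
Qed.

Lemma path_inf_glb c :
  (forall p, path (adj w) x p -> last x p = y -> c <= walk_length l x p) ->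
  c <= fine (path_inf w l x y).
Proof.
move=> cle; rewrite -lee_fin fineK ?path_inf_fin//.
by apply: le_ereal_inf_tmp => _ [q [xq qx] <-]; rewrite lee_fin cle.
Qed.

End Distance.

Lemma path_extension_ge0 l : edges_on (fun x y => 0 <= l x y) ->
  {in H &, forall x y, 0 <= path_extension w l x y}.
Proof.
move=> l0 x y xH yH; rewrite /path_extension; case: ifP => xy; first exact: l0.
by apply: path_inf_glb => // p xp _; exact: walk_length_ge0.
Qed.

Lemma path_extension_leZ l l' c : 0 < c ->
  edges_on (fun x y => 0 <= l x y) -> edges_on (fun x y => 0 <= l' x y) ->
  edges_on (fun x y => l x y <= c * l' x y) ->
  {in H &, forall x y, path_extension w l x y <= c * path_extension w l' x y}.
Proof.
move=> c0 l0 l'0 ll x y xH yH; rewrite /path_extension.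
case: ifP => xy; first exact: ll.
rewrite -ler_pdivrMl//; apply: path_inf_glb => // p xp px.
rewrite ler_pdivrMl// (le_trans (path_inf_le l0 xH yH xp px))//.
exact: walk_length_leZ.
Qed.

Lemma eq_path_inf l l' : (forall x y, adj w x y -> l x y = l' x y) ->
  path_inf w l =2 path_inf w l'.
Proof.
move=> ll x y; rewrite /path_inf; congr ereal_inf; apply/seteqP.
by split=> _ [p [xp px] <-]; exists p => //; rewrite (eq_walk_length ll xp).
Qed.

(** Path infima read lengths on edges only. Hence a metric of the flow can be rebuilt from its edge
    lengths. *)
Lemma path_extension_id l :
  path_extension w (path_extension w l) =2 path_extension w l.
Proof.
move=> x y; rewrite {1}/path_extension.
case: ifP => // xy; rewrite [RHS]/path_extension xy; congr fine.
by apply: eq_path_inf => u v; rewrite /path_extension => ->.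
Qed.

(** [path_extension] keeps edge lengths as they are; this condition says that no walk undercuts
    them, so that the extension is the path infimum on edges as well. *)
Definition geodesic_edges l := edges_on (fun x y =>
  forall p, path (adj w) x p -> last x p = y -> l x y <= walk_length l x p).

Lemma walk_rev l x p : edges_on (fun x y => l x y = l y x) -> x \in H ->
  path (adj w) x p -> exists q,
  [/\ path (adj w) (last x p) q, last (last x p) q = x &
      walk_length l (last x p) q = walk_length l x p].
Proof.
move=> lsym; elim: p x => [|y p IHp] x xH /=; first by exists [::].
move=> /andP[xy yp]; have yH := component_adj xy xH.
have [q [yq qy lq]] := IHp _ yH yp; exists (q ++ [:: x]); split.
- by rewrite cat_path yq/= qy w_sym xy.
- by rewrite last_cat.
- rewrite walk_length_cat lq qy !walk_length_cons walk_length_nil addr0 addrC.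
  by rewrite lsym// w_sym.
Qed.

(** With geodesic edges, the extension is the path infimum on all pairs of [H]. Symmetry then comes
    from reversing walks and the triangle inequality from concatenating them. *)
Lemma path_extension_metric l :
  edges_on (fun x y => 0 < l x y) -> edges_on (fun x y => l x y = l y x) ->
  geodesic_edges l -> (forall x, ~~ adj w x x) ->
  path_metric_on w H (path_extension w l).
Proof.
move=> lpos lsym lgeo irr; set D := path_extension w l.
have l0 : edges_on (fun x y => 0 <= l x y).
  by move=> x y xH yH xy; rewrite ltW// lpos.
have DE : {in H &, forall x y, D x y = fine (path_inf w l x y)}.
  move=> x y xH yH; rewrite /D /path_extension; case: ifP => // xy.
  apply: le_anti; rewrite path_inf_glb//=; last exact: lgeo.
  rewrite (le_trans (path_inf_le (p := [:: y]) l0 xH yH _ _))//= ?xy//.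
  by rewrite walk_length_cons walk_length_nil addr0.
have Dpos : {in H &, forall x y, D x y = 0 -> x = y}.
  move=> x y xH yH Dxy; apply/eqP; apply: contra_eqT Dxy => xy.
  rewrite DE// gt_eqF//.
  (* A walk leaving [x] starts with one of finitely many edges at [x], so the shortest of these
     bounds its length from below. *)
  apply: (@lt_le_trans _ _ (\big[Num.min/1]_(z | adj w x z) l x z)).
    by apply: lt_bigmin => // z xz; rewrite lpos// (component_adj xz).
  apply: path_inf_glb => // -[_ /= xy'|z p /= /andP[xz zp] _].
    by rewrite xy' eqxx in xy.
  rewrite walk_length_cons; apply: (@le_trans _ _ (l x z)).
    exact: bigmin_le_cond.
  by rewrite lerDl walk_length_ge0// (component_adj xz).
have Dsym : {in H &, forall x y, D x y <= D y x}.
  move=> x y xH yH; rewrite !DE//; apply: path_inf_glb => // p yp py.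
  have [q []] := walk_rev lsym yH yp; rewrite py => xq qx <-.
  exact: path_inf_le.
split; last first.
  move=> x y xH yH; rewrite DE// fineK ?path_inf_fin//.
  by apply: eq_path_inf => u v; rewrite /D /path_extension => ->.
split.
- exact: path_extension_ge0.
- move=> x y xH yH; split=> [|<-]; first exact: Dpos.
  apply: le_anti; rewrite path_extension_ge0// andbT DE//.
  by rewrite -(walk_length_nil l x); exact: path_inf_le.
- by move=> x y xH yH; apply: le_anti; rewrite !Dsym.
- move=> x y z xH yH zH; rewrite !DE// -lerBlDr.
  apply: path_inf_glb => // p xp px; rewrite lerBlDr -lerBlDl.
  apply: path_inf_glb => // q yq qy; rewrite lerBlDl -[in walk_length l y q]px.
  rewrite -walk_length_cat; apply: path_inf_le => //.
    by rewrite cat_path xp px.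
  by rewrite last_cat px.
Qed.

End Component.

(** * The flow and its surgery *)

Section Measure.
Variables (R : realType) (V : finType) (w : V -> V -> R) (m : V -> R).
Hypothesis hG : weighted_graph w m.
Implicit Types (x y z : V) (H : {set V}).

Lemma weighted_graph_adj_sym : symmetric (adj w).
Proof. by move=> x y; rewrite /adj (wg_sym hG). Qed.

Lemma weighted_graph_adj_irr x : ~~ adj w x x.
Proof. by rewrite /adj (wg_diag hG) ltxx. Qed.

Lemma not_adj_eq0 x y : ~~ adj w x y -> w x y = 0.
Proof.
by rewrite /adj -leNgt => wxy; apply: le_anti; rewrite wxy (wg_ge0 hG).
Qed.

(** Summing over all vertices makes the degrees of a graph and of a subgraph comparable term by
    term. *)
Lemma DegE x : Deg w m x = (\sum_y w x y) / m x.
Proof.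
rewrite /Deg mulr_suml big_mkcond; apply: eq_bigr => y _.
by case: ifPn => // /not_adj_eq0 ->; rewrite mul0r.
Qed.

Lemma rw_measure_probability H x : Deg w m x <= 1 -> is_component w H ->
  x \in H -> probability_on H (rw_measure w m x).
Proof.
move=> hDeg Hc xH; split.
- move=> z; rewrite /rw_measure; case: ifP => _; first by rewrite subr_ge0.
  by case: ifP => // _; rewrite divr_ge0 ?(wg_ge0 hG)// ltW// (wg_mass hG).
- rewrite (bigD1 x)//= {1}/rw_measure eqxx.
  rewrite [X in _ + X](_ : _ = Deg w m x) ?subrK// /Deg.
  rewrite big_mkcond [RHS]big_mkcond; apply: eq_bigr => z _.
  rewrite /rw_measure; case: eqVneq => //= ->.
  by rewrite (negPf (weighted_graph_adj_irr x)).
- move=> u; apply: contraNeq; rewrite /rw_measure.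
  have [->//|_] := eqVneq u x.
  by case: ifP => [xu _|_]; [exact: component_adj xu xH|rewrite eqxx].
Qed.
End Measure.

(** * One length update on a connected component *)

Section FlowLengths.
Variables (R : realType) (V : finType) (w : V -> V -> R) (m : V -> R).
Variables (alpha : R) (H : {set V}) (d : V -> V -> R).
Hypothesis hG : weighted_graph w m.
Hypothesis hDeg : forall x, Deg w m x <= 1.
Hypothesis halpha : 0 < alpha < 1.
Hypothesis Hc : is_component w H.

(** The curvature is cleared of its denominator: the update is a convex combination of the old
    distance and the Wasserstein distance. *)
Lemma flow_lengthsE x y : d x y != 0 -> flow_lengths alpha w m d x y =
  (1 - alpha) * d x y +
  alpha * wasserstein d (rw_measure w m x) (rw_measure w m y).
Proof. by move=> dxy; rewrite /flow_lengths /curvature; field. Qed.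

Hypothesis d_metric : metric_on H d.
Let W x y := wasserstein d (rw_measure w m x) (rw_measure w m y).
Let D x y := (1 - alpha) * d x y + alpha * W x y.
Let muP x (xH : x \in H) := rw_measure_probability hG (hDeg x) Hc xH.
Let a0 : 0 < alpha. Proof. by case/andP: halpha. Qed.
Let a1 : 0 < 1 - alpha. Proof. by case/andP: halpha; rewrite subr_gt0. Qed.

Let d_gt0 : edges_on w H (fun x y => 0 < d x y).
Proof.
move=> x y xH yH xy; rewrite lt_neqAle (metric_ge0 d_metric)// andbT eq_sym.
apply/eqP => /(metric_eq0 d_metric xH yH) xyE.
by have := weighted_graph_adj_irr hG x; rewrite {2}xyE xy.
Qed.

Let flowD : edges_on w H (fun x y => flow_lengths alpha w m d x y = D x y).
Proof. by move=> x y xH yH xy; rewrite flow_lengthsE// gt_eqF// d_gt0. Qed.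

Lemma flow_lengths_gt0 :
  edges_on w H (fun x y => 0 < flow_lengths alpha w m d x y).
Proof.
move=> x y xH yH xy; rewrite flowD// ltr_wpDr ?mulr_gt0 ?d_gt0//.
apply: mulr_ge0; first exact: ltW.
by apply: (wasserstein_ge0 (muP xH) (muP yH)); exact: metric_ge0.
Qed.

Lemma flow_lengths_sym : edges_on w H
  (fun x y => flow_lengths alpha w m d x y = flow_lengths alpha w m d y x).
Proof.
have Wle : {in H &, forall x y, W x y <= W y x}.
  move=> x y xH yH; apply: (wasserstein_le_sym (muP xH) (muP yH)).
  - exact: metric_ge0.
  - exact: Defs.metric_sym.
move=> x y xH yH xy; have yx : adj w y x by rewrite (weighted_graph_adj_sym hG).
rewrite (flowD xH yH xy) (flowD yH xH yx) /D (Defs.metric_sym d_metric)//.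
congr (_ + _ * _).
by apply: le_anti; rewrite !Wle.
Qed.

(** Both [d] and the Wasserstein distance satisfy the triangle inequality on all of [H], hence so
    does [D], which is then summed along the walk. *)
Lemma flow_lengths_geodesic : geodesic_edges w H (flow_lengths alpha w m d).
Proof.
move=> x y xH yH xy p; rewrite flowD//.
(* Adjacency of [x] and [y] is dropped, since the later vertices of the walk need not be adjacent to
   [y]. *)
elim: p x xH {xy} => [|z p IHp] x xH /=.
  move=> _ <-; rewrite /D (metric_eq0 d_metric xH xH).2// mulr0 add0r.
  rewrite walk_length_nil /W (wasserstein_refl (muP xH)) ?mulr0//.
    exact: metric_ge0.
  by move=> u uH; exact: (metric_eq0 d_metric uH uH).2.
move=> /andP[xz zp] py; have zH := component_adj Hc xz xH.
rewrite walk_length_cons flowD//.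
apply: (@le_trans _ _ (D x z + D z y)); last by rewrite lerD2l IHp.
rewrite /D addrACA -!mulrDr; apply: lerD; rewrite ler_pM2l//.
  exact: (Defs.metric_triangle d_metric).
apply: (wasserstein_triangle (muP xH) (muP zH) (muP yH)).
- exact: metric_ge0.
- exact: Defs.metric_triangle.
Qed.

End FlowLengths.

(** * Edge deletion *)

Section Surgery.
Variables (R : realType) (V : finType).
Implicit Types (w l : V -> V -> R) (m : V -> R) (H : {set V}).

Definition subgraph w' w :=
  (forall x y, w' x y = w' y x) /\ (forall x y, w' x y = 0 \/ w' x y = w x y).

Lemma subgraph_adj w' w x y : subgraph w' w -> adj w' x y -> adj w x y.
Proof. by rewrite /adj => -[_ /(_ x y)[]->]; rewrite ?ltxx. Qed.

Lemma delete_edge_subgraph w w' e :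
  subgraph w' w -> subgraph (delete_edge w' e) w.
Proof.
move=> [w'sym w'w]; split=> x y; rewrite /delete_edge.
- by rewrite orbC w'sym.
- by case: ifP => // _; left.
Qed.

Let step C l := fun w' (e : V * V) =>
  if too_long C w' l e.1 e.2 || too_long C w' l e.2 e.1
  then delete_edge w' e else w'.

Let steps_ind C l (I : (V -> V -> R) -> Prop) s w :
  (forall w' e, I w' -> I (delete_edge w' e)) -> I w ->
  I (foldl (step C l) w s).
Proof.
move=> Idel; elim: s w => //= e s IHs w Iw; apply: IHs.
by rewrite /step; case: ifP => // _; exact: Idel.
Qed.

Lemma surgery_subgraph C es w l : (forall x y, w x y = w y x) ->
  subgraph (surgery C es w l) w.
Proof.
move=> wsym; apply: (@steps_ind C l (fun w' => subgraph w' w)).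
  by move=> w' e; exact: delete_edge_subgraph.
by split=> // x y; right.
Qed.

(** A deleted edge keeps weight 0 in all later steps. If the outcome is [w], nothing was ever
    deleted and every test took place in [w] itself. *)
Let steps_fixed C l s w : all (fun e => adj w e.1 e.2) s ->
  foldl (step C l) w s = w ->
  forall e, e \in s -> ~~ (too_long C w l e.1 e.2 || too_long C w l e.2 e.1).
Proof.
elim: s => //= e s IHs /andP[we ws]; rewrite {2}/step; case: ifPn => test.
  move=> fix_w.
  have : foldl (step C l) (delete_edge w e) s e.1 e.2 = 0.
    apply: (@steps_ind C l (fun w' => w' e.1 e.2 = 0)).
      by move=> w' f w'e; rewrite /delete_edge; case: ifP.
    by rewrite /delete_edge -surjective_pairing eqxx.
  by rewrite fix_w => we0; move: we; rewrite /adj we0 ltxx.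
by move=> /(IHs ws) IH f; rewrite inE => /predU1P[->//|/IH].
Qed.

(** Each edge failed its test in [w]; the test looks at both ends, so the orientation listed in [es]
    does not matter. *)
Lemma surgery_fixed_ratio C es w0 w l : edge_listing w0 es -> subgraph w w0 ->
  surgery C es w l = w ->
  forall x y z, adj w x y -> adj w y z -> l x y <= C * l y z.
Proof.
move=> [_ hes] sub fix_w x y z xy yz; rewrite leNgt; apply/negP => lxy.
have long : too_long C w l x y by apply/existsP; exists z; rewrite yz.
have short := steps_fixed _ fix_w.
have {}short e : e \in es -> adj w e.1 e.2 ->
    ~~ (too_long C w l e.1 e.2 || too_long C w l e.2 e.1).
  move=> ees we; apply: short; rewrite ?mem_sort ?mem_filter ?we//.
  by apply/allP => f; rewrite mem_sort mem_filter => /andP[].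
have yx : adj w y x by rewrite /adj -(sub.1 x y).
have /orP[ein|ein] : ((x, y) \in es) || ((y, x) \in es).
  apply: contraT; rewrite negb_or -!has_pred1 !has_count -!eqn0Ngt.
  move=> /andP[/eqP c1 /eqP c2].
  by have := hes x y (subgraph_adj sub xy); rewrite c1 c2.
- by have := short _ ein xy; rewrite long.
- by have := short _ ein yx; rewrite long orbT.
Qed.

Lemma subgraph_weighted_graph w' w m : subgraph w' w -> weighted_graph w m ->
  weighted_graph w' m.
Proof.
move=> [w'sym w'w] hG; split=> //; last exact: wg_mass hG.
- by move=> x y; have [->|->] := w'w x y; rewrite ?(wg_ge0 hG).
- by move=> x; have [->|->] := w'w x x; rewrite ?(wg_diag hG).
Qed.

Lemma subgraph_Deg w' w m x : subgraph w' w -> weighted_graph w m ->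
  Deg w' m x <= Deg w m x.
Proof.
move=> sub hG; have hG' := subgraph_weighted_graph sub hG.
rewrite (DegE hG) (DegE hG') ler_pM2r ?invr_gt0 ?(wg_mass hG)//.
by apply: ler_sum => y _; have [->|->] := sub.2 x y; rewrite ?(wg_ge0 hG).
Qed.

Lemma subgraph_component w' w H' : subgraph w' w -> is_component w' H' ->
  exists2 H, is_component w H & H' \subset H.
Proof.
move=> sub [x ->]; exists [set y | connect (adj w) x y]%SET; first by exists x.
apply/fintype.subsetP => y; rewrite !inE; apply: connect_sub => u v uv.
by apply/connect1/(subgraph_adj sub).
Qed.

Lemma subgraph_edges_eq w' w m : subgraph w' w -> weighted_graph w m ->
  (#|[set e | adj w e.1 e.2]%SET| <= #|[set e | adj w' e.1 e.2]%SET|)%N ->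
  w' = w.
Proof.
move=> sub hG card_le; apply/funext => x; apply/funext => y.
have /eqP edges_eq :
    [set e | adj w' e.1 e.2]%SET == [set e | adj w e.1 e.2]%SET.
  rewrite eqEcard card_le andbT; apply/fintype.subsetP => e; rewrite !inE.
  exact: subgraph_adj.
have [w'0|//] := sub.2 x y; rewrite w'0; apply/esym/(not_adj_eq0 hG).
have /setP/(_ (x, y)) := edges_eq; rewrite !inE /= => <-.
by rewrite /adj w'0 ltxx.
Qed.

End Surgery.

Lemma nonincreasing_nat_stationary (u : nat -> nat) :
  (forall n, (u n.+1 <= u n)%N) ->
  exists N, forall n, (N <= n)%N -> u n = u N.
Proof.
move=> u_decr.
have [k] := ubnP (u 0%N); elim: k u u_decr => // k IHk u u_decr uk.
have [[n un]|u0] := pselect (exists n, (u n < u 0)%N).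
  have nk : (u (n + 0) < k)%N by rewrite addn0; exact: leq_trans un uk.
  have [i|N uN] := IHk (fun i => u (n + i)%N) _ nk; first by rewrite addnS.
  exists (n + N)%N => i ni.
  have n_le : (n <= i)%N := leq_trans (leq_addr N n) ni.
  by rewrite -(subnKC n_le) uN// leq_subRL.
have u_le n : (u n <= u 0)%N by elim: n => // n; exact: leq_trans.
exists 0%N => n _; apply/eqP; rewrite eqn_leq u_le leqNgt.
by apply/negP => un; apply: u0; exists n.
Qed.

(** * The graphs and metrics along the flow *)

Section RicciFlow.
Variables (R : realType) (V : finType) (w : V -> V -> R) (m : V -> R).
Variables (d0 : V -> V -> R) (alpha C : R) (es : seq (V * V)).
Hypothesis hG : weighted_graph w m.
Hypothesis hDeg : forall x, Deg w m x <= 1.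
Hypothesis hd0 : metric_on [set: V]%SET d0.
Hypothesis halpha : 0 < alpha < 1.
Hypothesis hes : edge_listing w es.

Local Notation w_ n := (flow_graph alpha C es w m d0 n).
Local Notation d_ n := (flow_metric alpha C es w m d0 n).
Local Notation l_ n := (flow_lengths alpha (w_ n) m (d_ n)).

Lemma flow_graphS n : w_ n.+1 = surgery C es (w_ n) (l_ n).
Proof. by []. Qed.

Lemma flow_metricS n : d_ n.+1 = path_extension (w_ n.+1) (l_ n).
Proof. by []. Qed.

Lemma flow_graph_weighted n : weighted_graph (w_ n) m.
Proof.
elim: n => [//|n IHn]; apply: subgraph_weighted_graph (IHn).
by apply: surgery_subgraph => x y; exact: wg_sym IHn _ _.
Qed.

Lemma flow_graph_subgraph n : subgraph (w_ n.+1) (w_ n).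
Proof.
apply: surgery_subgraph => x y; exact: wg_sym (flow_graph_weighted n) _ _.
Qed.

Lemma flow_graph_subgraph0 n : subgraph (w_ n) w.
Proof.
elim: n => [|n [_ IHn]]; first by split=> x y; [exact: wg_sym hG _ _|right].
have [sym sub] := flow_graph_subgraph n; split=> // x y.
by have [->|->] := sub x y; [left|exact: IHn].
Qed.

Lemma flow_graph_Deg n x : Deg (w_ n) m x <= 1.
Proof.
apply: le_trans (hDeg x); apply: subgraph_Deg hG; exact: flow_graph_subgraph0.
Qed.

(** A component after surgery lies inside a component before it, and its walks are walks of the old
    graph. Deletion therefore keeps the remaining edges geodesic. *)
Lemma flow_metric_metric n H : is_component (w_ n) H -> metric_on H (d_ n).
Proof.
elim: n H => [|n IHn] H' Hc'.
  have [ge0 eq0 sym tri] := hd0.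
  split=> [x y|x y|x y|x y z] *;
    by [apply: ge0|apply: eq0|apply: sym|apply: tri]; rewrite inE.
have sub := flow_graph_subgraph n.
have hGn := flow_graph_weighted n; have hDegn := flow_graph_Deg n.
have [H Hc /fintype.subsetP H'H] := subgraph_component sub Hc'.
have dH := IHn H Hc.
rewrite flow_metricS; apply: (path_extension_metric _ Hc' _ _ _ _).1.
- exact: weighted_graph_adj_sym (flow_graph_weighted n.+1).
- move=> x y /H'H xH /H'H yH /(subgraph_adj sub) xy.
  exact: (flow_lengths_gt0 hGn hDegn halpha Hc dH).
- move=> x y /H'H xH /H'H yH /(subgraph_adj sub) xy.
  exact: (flow_lengths_sym _ hGn hDegn Hc dH).
- move=> x y /H'H xH /H'H yH /(subgraph_adj sub) xy p xp.
  apply: (flow_lengths_geodesic hGn hDegn halpha Hc dH) => //.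
  by apply: sub_path xp => u v; exact: subgraph_adj.
- exact: weighted_graph_adj_irr (flow_graph_weighted n.+1).
Qed.

(** The number of edges is nonincreasing, hence eventually constant, and a subgraph with as many
    edges is the whole graph. *)
Lemma flow_graph_stationary : exists N, forall n, (N <= n)%N -> w_ n = w_ N.
Proof.
have [|N cardN] := @nonincreasing_nat_stationary
    (fun n => #|[set e | adj (w_ n) e.1 e.2]%SET|).
  move=> n; apply/subset_leq_card/fintype.subsetP => e; rewrite !inE.
  exact: subgraph_adj (flow_graph_subgraph n).
exists N => n /subnKC <-.
elim: (n - N)%N => {n} [|k IHk]; first by rewrite addn0.
rewrite -[RHS]IHk addnS.
apply: (subgraph_edges_eq (flow_graph_subgraph _) (flow_graph_weighted _)).
by rewrite -addnS !cardN// leq_addr.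
Qed.

(** * Convergence on a component of the final graph *)

Section Limit.
Variables (N : nat) (H : {set V}).
Let wf := w_ N.
Hypothesis wN : forall n, (N <= n)%N -> w_ n = wf.
Hypothesis Hc : is_component wf H.
Hypothesis H_edge : edges_in wf H != finset.set0.

Let A := edges_in wf H.
(** The shift is [N.+1] because only from then on does each metric come from a step that both starts
    and ends at [wf]. *)
Let F k (e : V * V) := d_ (k + N.+1) e.1 e.2.
Let hGf : weighted_graph wf m := flow_graph_weighted N.
Let wf_sym := weighted_graph_adj_sym hGf.
Let wN' k : w_ (k + N) = wf. Proof. by rewrite wN// leq_addl. Qed.
Let alpha_gt0 : 0 < alpha. Proof. by case/andP: halpha. Qed.
Let alpha_lt1 : 0 < 1 - alpha.
Proof. by case/andP: halpha; rewrite subr_gt0. Qed.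
Let muP x (xH : x \in H) :=
  rw_measure_probability hGf (flow_graph_Deg N x) Hc xH.

Let AP x y : (x, y) \in A -> [/\ x \in H, y \in H & adj wf x y].
Proof. by rewrite inE => /and3P[]. Qed.

Let dE k : d_ (k + N.+1) = path_extension wf (l_ (k + N)).
Proof. by rewrite addnS flow_metricS -addSn wN'. Qed.

Let dF k : path_extension wf (fun x y => F k (x, y)) = d_ (k + N.+1).
Proof.
rewrite [RHS]dE -[RHS](funext (fun x => funext (path_extension_id wf _ x))).
by congr path_extension; rewrite -dE.
Qed.

Let dmet k : metric_on H (d_ (k + N.+1)).
Proof.
apply: flow_metric_metric.
by rewrite wN ?leqW ?leq_addl// addnS leqW// leq_addl.
Qed.

Let lE k x y : adj wf x y -> d_ (k + N.+1) x y = l_ (k + N) x y.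
Proof. by move=> xy; rewrite dE /path_extension xy. Qed.

Let dN k : metric_on H (d_ (k + N)).
Proof. by apply: flow_metric_metric; rewrite wN'. Qed.

Let d_gt0 k : edges_on wf H (fun x y => 0 < d_ (k + N.+1) x y).
Proof.
move=> x y xH yH xy; rewrite lE// wN'.
exact: (flow_lengths_gt0 hGf (flow_graph_Deg N) halpha Hc (dN k)).
Qed.

Let F_gt0 k : positive_on A (F k).
Proof. by move=> [x y] /AP[xH yH xy]; exact: d_gt0. Qed.

(** With [a = 1 - alpha], this puts the flow in the form studied for monotone homogeneous maps,
    acting on edge lengths alone. *)
Let Q (f : V * V -> R) (e : V * V) : R :=
  alpha * wasserstein (path_extension wf (fun x y => f (x, y)))
    (rw_measure wf m e.1) (rw_measure wf m e.2).

Let edges_positive (f : V * V -> R) : positive_on A f ->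
  edges_on wf H (fun x y => 0 <= f (x, y)).
Proof. by move=> f0 x y xH yH xy; apply/ltW/f0; rewrite inE xH yH. Qed.

Let Q_ge0 (f : V * V -> R) : positive_on A f -> {in A, forall e, 0 <= Q f e}.
Proof.
move=> f0 [x y] /AP[xH yH _]; apply: mulr_ge0; first exact: ltW.
apply: (wasserstein_ge0 (muP xH) (muP yH)).
exact: (path_extension_ge0 wf_sym Hc (edges_positive f0)).
Qed.

Let Q_le (f g : V * V -> R) (c : R) :
  positive_on A f -> positive_on A g -> 0 < c ->
  {in A, forall e, f e <= c * g e} -> {in A, forall e, Q f e <= c * Q g e}.
Proof.
move=> f0 g0 c0 fg [x y] /AP[xH yH _]; rewrite /Q mulrCA ler_pM2l//.
apply: (wasserstein_leZ (muP xH) (muP yH)) => //.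
  exact: (path_extension_ge0 wf_sym Hc (edges_positive f0)).
apply: (path_extension_leZ wf_sym Hc) => //; try exact: edges_positive.
by move=> u v uH vH uv; rewrite fg// inE uH vH.
Qed.

Let F_step k : {in A, F k.+1 =1 (fun e => (1 - alpha) * F k e + Q (F k) e)}.
Proof.
move=> [x y] /AP[xH yH xy]; rewrite {1}/F lE// addSnnS.
have -> : w_ (k + N.+1) = wf by rewrite addnS -addSn.
by rewrite /Q dF flow_lengthsE// gt_eqF// d_gt0.
Qed.

Let F_adjacent k x y z : adj wf x y -> adj wf y z ->
  F k (x, y) <= C * F k (y, z).
Proof.
move=> xy yz; rewrite /F !lE//.
have fix_w : surgery C es wf (l_ (k + N)) = wf.
  by rewrite -{1}(wN' k) -flow_graphS -addSn.
exact: (surgery_fixed_ratio hes (flow_graph_subgraph0 N) fix_w).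
Qed.

Let edge0 : exists e, e \in A.
Proof. exact/set0Pn. Qed.

Let F_sym k x y : (x, y) \in A -> F k (x, y) = F k (y, x).
Proof. by move=> /AP[xH yH _]; exact: (Defs.metric_sym (dmet k)). Qed.

Let A_sym x y : (x, y) \in A -> (y, x) \in A.
Proof. by move=> /AP[xH yH xy]; rewrite inE xH yH wf_sym. Qed.

(** The walk from [x] to [y] and back compares an edge with itself. This allows powers of [C] to be
    enlarged. *)
Let C_ge1 : 1 <= C.
Proof.
have [[x y] xyA] := edge0; have [xH yH xy] := AP xyA.
have [_ _ yx] := AP (A_sym xyA).
have le_C := F_adjacent 0 xy yx.
rewrite -(ler_pM2r (F_gt0 0 (A_sym xyA))) mul1r.
by apply: le_trans le_C; rewrite (F_sym 0 xyA).
Qed.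

Let F_walk k p x y z : adj wf x y -> path (adj wf) y p ->
  adj wf (last y p) z -> F k (x, y) <= C ^+ (size p).+1 * F k (last y p, z).
Proof.
elim: p x y => [|u p IHp] x y xy /=; first by move=> _; exact: F_adjacent.
move=> /andP[yu up] uz; apply: (le_trans (F_adjacent k xy yu)).
rewrite exprS -mulrA ler_pM2l ?IHp//.
exact: lt_le_trans ltr01 C_ge1.
Qed.

Let F_ratio k : {in A &, forall e e', F k e <= C ^+ #|V| * F k e'}.
Proof.
move=> [x y] [u v] /AP[xH yH xy] uvA; have [uH vH uv] := AP uvA.
have [p] := component_walk wf_sym Hc yH uH.
(* A walk without repeated vertices has fewer than [#|V|] edges, which gives an exponent independent
   of the two edges and of time. *)
case/shortenP => q yq uq _ qu.
have := F_walk k xy yq; rewrite qu => /(_ v uv)/le_trans; apply.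
rewrite ler_pM2r ?F_gt0// ler_weXn2l//.
by have := max_card (mem (y :: q)); rewrite (card_uniqP uq).
Qed.

Lemma normalized_flow_limit : exists2 d : V -> V -> R,
  (forall e, e \in edges_in wf H ->
    (fun n => d_ n e.1 e.2 / max_length wf H (d_ n)) @ \oo --> d e.1 e.2) &
  constant_curvature wf m H d.
Proof.
have [h h0 [c c0 [hc Fh]]] :=
  normalized_orbit_cvg edge0 alpha_lt1 Q_ge0 Q_le F_gt0 F_step F_ratio.
pose X k := \big[Num.max/0]_(e in A) F k e.
have X0 k : 0 < X k.
  have [e eA] := edge0; apply: (lt_le_trans (F_gt0 k eA)).
  exact: (le_bigmax_cond _ (F k)).
pose l x y := h (x, y).
pose d := path_extension wf l.
have dA x y : (x, y) \in A -> d x y = h (x, y).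
  by move=> /AP[_ _ xy]; rewrite /d /path_extension xy.
have inA : edges_on wf H (fun x y => (x, y) \in A).
  by move=> x y xH yH xy; rewrite inE xH yH.
have l_gt0 : edges_on wf H (fun x y => 0 < l x y).
  by move=> x y xH yH xy; apply/h0/inA.
have l_sym : edges_on wf H (fun x y => l x y = l y x).
  move=> x y xH yH xy; have xyA := inA x y xH yH xy.
  have hyx : F n (x, y) / X n @[n --> \oo] --> l y x.
    have -> : (fun n => F n (x, y) / X n) = (fun n => F n (y, x) / X n).
      by apply/funext => n; rewrite F_sym.
    by apply: Fh; exact: A_sym.
  exact: (cvg_unique (@Rhausdorff R) (Fh _ xyA) hyx).
have l_walk x p : x \in H -> path (adj wf) x p ->
    walk_length (fun x y => F n (x, y) / X n) x p @[n --> \oo] -->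
    walk_length l x p.
  elim: p x => [|y p IHp] x xH /=.
    move=> _; rewrite walk_length_nil; under eq_fun do rewrite walk_length_nil.
    exact: cvg_cst.
  move=> /andP[xy yp]; have yH := component_adj Hc xy xH.
  rewrite walk_length_cons; under eq_fun do rewrite walk_length_cons.
  by apply: cvgD; [exact/Fh/inA|exact: IHp].
(* Edges are geodesic at every time, and the inequality passes to the limit after division by
   [X k]. *)
have l_geo : geodesic_edges wf H l.
  move=> x y xH yH xy p xp px.
  apply: (ler_cvg_to (Fh _ (inA x y xH yH xy)) (l_walk x p xH xp)).
  apply: nearW => k; rewrite (ler_pdivrMr _ _ (X0 k)) [leRHS]mulrC.
  have le_walk : walk_length (l_ (k + N)) x p <=
      X k * walk_length (fun x y => F k (x, y) / X k) x p.
    apply: (walk_length_leZ Hc) => // u v uH vH uv.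
    by rewrite mulrC divfK ?gt_eqF// /F lE.
  apply: le_trans le_walk; rewrite /F lE//.
  have := flow_lengths_geodesic hGf (flow_graph_Deg N) halpha Hc (dN k).
  by rewrite wN'; exact.
have dmetric := path_extension_metric wf_sym Hc l_gt0 l_sym l_geo
  (weighted_graph_adj_irr hGf).
exists d.
  move=> [x y] xyA; rewrite dA// -(cvg_shiftn N.+1); exact: Fh.
split=> //.
  by move=> [x y] xyA; rewrite dA// h0.
(* The eigenvector equation reads [d - alpha * kappa * d = c * d] on edges, where [kappa] is the
   curvature; dividing by [d] gives this value. *)
exists ((1 - c) / alpha) => -[x y] xyA /=.
have dxy : d x y != 0 by rewrite dA// gt_eqF// h0.
have := hc _ xyA; rewrite -(dA _ _ xyA) /Q -[path_extension _ _]/d/=.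
rewrite -(flow_lengthsE wf m alpha dxy) /flow_lengths => flow_d.
have {}flow_d : alpha * curvature wf m d x y = 1 - c.
  apply: (mulIf dxy); rewrite mulrBl mul1r -flow_d.
  by rewrite opprB addrC subrK.
by rewrite -flow_d mulrC mulKf// gt_eqF.
Qed.

End Limit.
End RicciFlow.

Theorem theorem4 (R : realType) (V : finType)
    (w : V -> V -> R) (m : V -> R) (d0 : V -> V -> R)
    (alpha C : R) (es : seq (V * V))
    (hG : weighted_graph w m)
    (hDeg : forall x : V, Deg w m x <= 1)
    (hd0 : path_metric_on w [set: V]%SET d0)
    (halpha : 0 < alpha < 1)
    (hC : forall x y z : V, adj w x y -> adj w y z -> d0 x y / d0 y z < C)
    (hes : edge_listing w es) :
  exists2 wfin : V -> V -> R,
    (\forall n \near \oo, flow_graph alpha C es w m d0 n = wfin) &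
    forall H : {set V}, is_component wfin H -> edges_in wfin H != finset.set0 ->
      exists2 d : V -> V -> R,
        (forall e : V * V, e \in edges_in wfin H ->
           (fun n : nat => flow_metric alpha C es w m d0 n e.1 e.2
              / max_length wfin H (flow_metric alpha C es w m d0 n))
             @ \oo --> d e.1 e.2) &
        constant_curvature wfin m H d.
Proof.
have [N wN] := flow_graph_stationary d0 alpha C es hG.
exists (flow_graph alpha C es w m d0 N).
  by exists N.
move=> H Hc H_edge.
exact: (normalized_flow_limit hG hDeg hd0.1 halpha hes wN Hc H_edge).
Qed.
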